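(* Let $\lambda\in\mathbb R\setminus\{0\}$, let $n>1$ be an integer, let $Q_1,Q_2$ be non-zero real homogeneous polynomials of degree $n$ in $(x,y)$, and consider the planar system $\dot x=\lambda x+Q_1(x,y)$, $\dot y=\lambda y+Q_2(x,y)$. If this system has finitely many infinite equilibria, then: (a) for all $n>1$ there are at most $2(n+1)$ infinite equilibria; (b) if $n$ is odd, then the number of finite equilibria away from the origin is at most $2(n+1)$; (c) if $n$ is even, then the number of finite equilibria away from the origin is at most $n+1$.
   Context: Polar form: with $(x,y)=(r\cos\theta,r\sin\theta)$ the system is $\dot r=\lambda r+f(\theta)r^n$, $\dot\theta=g(\theta)r^{n-1}$, where $f(\theta)=\cos\theta\,Q_1(\cos\theta,\sin\theta)+\sin\theta\,Q_2(\cos\theta,\sin\theta)$ and $g(\theta)=\cos\theta\,Q_2(\cos\theta,\sin\theta)-\sin\theta\,Q_1(\cos\theta,\sin\theta)$. The Poincaré disk is the compactification of $\mathbb R^2$ obtained by adding the circle at infinity (one point for each direction $\theta\in\mathbb R/2\pi\mathbb Z$). Near this circle, with $R=1/r$ and after multiplication by the positive factor $R^{n-1}$, the flow is $\dot R=-\lambda R^n-Rf(\theta)$, $\dot\theta=g(\theta)$, and the circle at infinity is $R=0$. An infinite equilibrium is an equilibrium on the circle at infinity, i.e. a point $(R,\theta)=(0,\theta_0)$ with $g(\theta_0)=0$. Finite equilibria are the equilibria in $\mathbb R^2$. *)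

(* Defs.v *)
From mathcomp Require Import all_boot all_order all_algebra.
From mathcomp Require Import mpoly.
From mathcomp Require Import classical_sets functions cardinality reals trigo.

Set Implicit Arguments.
Unset Strict Implicit.
Unset Printing Implicit Defensive.

Import Order.TTheory GRing.Theory Num.Theory.
Local Open Scope classical_set_scope.
Local Open Scope ring_scope.

Section Definitions.
Variable R : realType.
Implicit Types (lambda x y t : R) (n : nat) (Q : {mpoly R[2]}) (p : R * R).

Definition eval2 Q x y : R := Q.@[tnth [tuple x; y]].

Definition planar_field lambda Q1 Q2 p : R * R :=
  (lambda * p.1 + eval2 Q1 p.1 p.2, lambda * p.2 + eval2 Q2 p.1 p.2).

Definition finite_equilibria lambda Q1 Q2 : set (R * R) :=
  [set p | planar_field lambda Q1 Q2 p = (0, 0)].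

(* In polar coordinates the planar system reads
   r' = lambda r + f(t) r^n,  t' = g(t) r^(n-1). *)
Definition polar_f Q1 Q2 t : R :=
  cos t * eval2 Q1 (cos t) (sin t) + sin t * eval2 Q2 (cos t) (sin t).

Definition polar_g Q1 Q2 t : R :=
  cos t * eval2 Q2 (cos t) (sin t) - sin t * eval2 Q1 (cos t) (sin t).

(* The vector field near the circle at infinity, in the coordinates
   p = (1 / r, t) and after multiplication by (1 / r)^(n-1). *)
Definition infinity_field lambda n Q1 Q2 p : R * R :=
  (- lambda * p.1 ^+ n - p.1 * polar_f Q1 Q2 p.2, polar_g Q1 Q2 p.2).

(* The circle at infinity R / (2 pi Z) is the line {0} x R of these coordinates
   modulo 2 pi in t; each of its points is represented by its unique angle in
   [0, 2 pi[. *)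
Definition infinite_equilibria lambda n Q1 Q2 : set R :=
  [set t | 0 <= t < 2 * pi /\ infinity_field lambda n Q1 Q2 (0, t) = (0, 0)].

End Definitions.

(* Main.v *)
Require Import Defs.
From mathcomp Require Import all_boot all_order all_algebra.
From mathcomp Require Import mpoly ring lra.
From mathcomp Require Import boolp classical_sets functions cardinality reals trigo.

Set Implicit Arguments.
Unset Strict Implicit.
Unset Printing Implicit Defensive.

Import Order.TTheory GRing.Theory Num.Theory.
Local Open Scope classical_set_scope.
Local Open Scope card_scope.
Local Open Scope ring_scope.

(** Write G = x Q2 - y Q1, a binary form of degree n + 1.  It governs both kinds
    of equilibria.  At infinity, theta' = g(theta) = G(cos theta, sin theta), so
    an infinite equilibrium is a point of the unit circle where G vanishes.  At
    a finite equilibrium, Q1 = - lambda x and Q2 = - lambda y, so G vanishes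
    there as well: the field is radial on the zero lines of G.

    If G vanished identically, every direction would be an infinite equilibrium
    ([infinite_angles]); hence G is not zero, and being a form of degree n + 1 it
    vanishes on at most n + 1 lines through the origin ([zero_lines]).  It
    remains to count the equilibria on one such line.  Two points p and k p of
    the unit circle have k = 1 or k = -1, which gives at most 2 (n + 1) infinite
    equilibria.  If p and k p are nonzero finite equilibria, comparing
    lambda p + Q(p) = 0 with lambda k p + k^n Q(p) = 0 gives k^(n-1) = 1
    ([finite_equilibria_ratio]).  For n odd this leaves k = 1 or k = -1, hence
    at most two equilibria per line; for n even it forces k = 1, hence at most
    one.  The lemmas [card_points] and [card_antipodal_points] turn these two
    situations into cardinality bounds. *)

(** * Binary forms and their zero lines *)

Lemma eval2E (R : realType) (Q : {mpoly R[2]}) x y :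
  eval2 Q x y = \sum_(m <- msupp Q) Q@_m * (x ^+ m ord0 * y ^+ m (lift ord0 ord0)).
Proof.
rewrite /eval2 mevalE; apply: eq_bigr => m _.
by rewrite !big_ord_recl big_ord0 mulr1.
Qed.

Lemma homog_mdeg2 (R : realType) (n : nat) (Q : {mpoly R[2]}) :
  Q \is n.-homog -> {in msupp Q, forall m : 'X_{1..2}, (m ord0 + m (lift ord0 ord0) = n)%N}.
Proof.
move=> /dhomogP homQ m mQ; have <- : mdeg m = n := homQ m mQ.
by rewrite mdegE !big_ord_recl big_ord0 addn0.
Qed.

Lemma eval2_homog (R : realType) (n : nat) (Q : {mpoly R[2]}) (k x y : R) :
  Q \is n.-homog -> eval2 Q (k * x) (k * y) = k ^+ n * eval2 Q x y.
Proof.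
move=> homQ; rewrite !eval2E mulr_sumr; apply: eq_big_seq => m mQ.
rewrite -(homog_mdeg2 homQ mQ) !exprMn exprD; ring.
Qed.

(** The polynomial G(s, 1).  It is a sum of monomials of G rather than an
    evaluation so that its coefficient of degree deg G can be read off. *)
Definition dehomog (R : realType) (G : {mpoly R[2]}) : {poly R} :=
  \sum_(m <- msupp G) G@_m *: 'X^(m ord0).

Lemma horner_dehomog (R : realType) (G : {mpoly R[2]}) s :
  (dehomog G).[s] = eval2 G s 1.
Proof.
rewrite eval2E /dehomog horner_sum; apply: eq_bigr => m _.
by rewrite hornerZ hornerXn expr1n mulr1.
Qed.

Lemma size_dehomog (R : realType) (m : nat) (G : {mpoly R[2]}) :
  G \is m.-homog -> (size (dehomog G) <= m.+1)%N.
Proof.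
move=> homG; apply: leq_trans (size_sum _ _ _) _.
apply/bigmax_leqP_seq => i iG _; apply: leq_trans (size_scale_leq _ _) _.
by rewrite size_polyXn ltnS -(homog_mdeg2 homG iG) leq_addr.
Qed.

Lemma eval2_dehomog (R : realType) (m : nat) (G : {mpoly R[2]}) x y :
  G \is m.-homog -> y != 0 -> eval2 G x y = y ^+ m * (dehomog G).[x / y].
Proof.
move=> homG y0; rewrite horner_dehomog -(eval2_homog _ _ _ homG) mulr1.
by rewrite mulrCA divff// mulr1.
Qed.

(** The line y = 0 is the point at infinity of the affine chart s = x / y: it is
    a zero line exactly when the degree of the dehomogenized form drops. *)
Lemma eval2_horizontal (R : realType) (m : nat) (G : {mpoly R[2]}) x :
  G \is m.-homog -> eval2 G x 0 = x ^+ m * (dehomog G)`_m.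
Proof.
move=> homG; rewrite eval2E /dehomog coef_sum mulr_sumr.
apply: eq_big_seq => i iG; rewrite coefZ coefXn -(homog_mdeg2 homG iG).
rewrite -[X in (_ == X)%N]addn0 eqn_add2l expr0n.
have [->|_] := eqVneq (i (lift ord0 ord0)) 0%N; last by rewrite /=; ring.
by rewrite addn0 /=; ring.
Qed.

(** Splitting off one linear factor at a time lists all the roots, each with its
    multiplicity. *)
Lemma root_cover (R : realType) (p : {poly R}) :
  p != 0 -> exists2 s, (size s < size p)%N & forall x, root p x -> x \in s.
Proof.
have [n] := ubnP (size p); elim: n p => // n IHn p lepn p0.
have [[x px]|nroot] := pselect (exists x, root p x); last first.
  exists [::]; first by rewrite size_poly_gt0.
  by move=> x px; case: nroot; exists x.
have /factor_theorem[q pE] := px.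
have q0 : q != 0 by apply: contraNneq p0 => q0; rewrite pE q0 mul0r.
have sizep : size p = (size q).+1 by rewrite pE size_Mmonic ?monicXsubC// size_XsubC addn2.
have [||s les sP] := IHn q => //; first by move: lepn; rewrite sizep ltnS.
exists (x :: s) => [|y]; first by rewrite sizep.
by rewrite pE rootM root_XsubC in_cons orbC => /orP[->//|/sP ->]; rewrite orbT.
Qed.

(** The line through the origin and a nonzero point, as a point of the
    projective line: [Some s] is the line x = s y, [None] the line y = 0. *)
Definition line_of (R : realType) (p : R * R) : option R :=
  if p.2 == 0 then None else Some (p.1 / p.2).

Lemma line_of_eq (R : realType) (p q : R * R) :
  p != (0, 0) -> line_of p = line_of q -> exists k, q = (k * p.1, k * p.2).
Proof.
case: p q => [x y] [x' y']; rewrite /line_of /= xpair_eqE negb_and.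
have [->|y0] := eqVneq y 0; have [->|y'0] := eqVneq y' 0 => //=.
  by rewrite orbF => x0 _; exists (x' / x); rewrite divfK// mulr0.
move=> _ [xy]; exists (y' / y); rewrite divfK//; congr (_, _).
by rewrite mulrAC -mulrA xy mulrC divfK.
Qed.

(** The zero lines other than y = 0 are the roots of G(s, 1).  When y = 0 is a
    zero line too, the degree of G(s, 1) is less than m, and the root lost in
    this way pays for the extra line. *)
Lemma zero_lines (R : realType) (m : nat) (G : {mpoly R[2]}) (q : R * R) :
    G \is m.-homog -> eval2 G q.1 q.2 != 0 ->
  exists2 L : seq (option R), (size L <= m)%N &
    forall p, p != (0, 0) -> eval2 G p.1 p.2 = 0 -> line_of p \in L.
Proof.
case: q => [x0 y0] homG /= Gq.
have P0 : dehomog G != 0.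
  apply: contraNneq Gq => P0; have [->|y00] := eqVneq y0 0.
    by rewrite (eval2_horizontal _ homG) P0 coef0 mulr0.
  by rewrite (eval2_dehomog _ homG y00) P0 horner0 mulr0.
have [s les sP] := root_cover P0.
have leP := size_dehomog homG.
have finite_slope x y : y != 0 -> eval2 G x y = 0 -> x / y \in s.
  move=> y00 /eqP; rewrite (eval2_dehomog _ homG y00) mulf_eq0 expf_eq0.
  by rewrite (negbTE y00) andbF /= => /sP.
have [Pm|Pm] := eqVneq (dehomog G)`_m 0.
  exists (None :: map Some s).
    rewrite /= size_map; apply: leq_trans les _.
    rewrite leqNgt; apply: contra_eqN Pm => Pm.
    have sizeP : size (dehomog G) = m.+1 by apply/eqP; rewrite eqn_leq leP.
    by have := P0; rewrite -lead_coef_eq0 lead_coefE sizeP.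
  move=> [x y] _ /= Gxy; rewrite /line_of /= in_cons.
  have [//|y00] := eqVneq y 0.
  by rewrite map_f ?orbT// finite_slope.
exists (map Some s); first by rewrite size_map -ltnS (leq_trans les).
move=> [x y] /= p0 Gxy; rewrite /line_of /=.
have [yE|y00] := eqVneq y 0; last by rewrite map_f// finite_slope.
move: p0 Gxy; rewrite yE (eval2_horizontal _ homG) xpair_eqE eqxx andbT => x00.
by move/eqP; rewrite mulf_eq0 (negbTE Pm) orbF expf_eq0 (negbTE x00) andbF.
Qed.

(** * Counting points on finitely many lines *)

Lemma card_le_seq (T : Type) (U : eqType) (A : set T) (f : T -> U) (s : seq U) :
    (forall x, A x -> f x \in s) ->
    (forall x y, A x -> A y -> f x = f y -> x = y) -> A #<= `I_(size s).
Proof.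
move=> fs finj; pose g x := index (f x) s.
have ginj : {in A &, injective g}.
  move=> x y; rewrite !inE => Ax Ay gxy; apply: finj => //.
  by rewrite -(nth_index (f x) (fs x Ax)) [index _ _]gxy nth_index// fs.
rewrite -(card_le_eql (inj_card_eq ginj)); apply: subset_card_le => _ [x Ax <-].
by rewrite /= index_mem fs.
Qed.

(** The half-plane of the points with angle in [0, pi[; it contains exactly one
    of p and - p when p is nonzero. *)
Definition upper (R : realType) (p : R * R) : bool :=
  (0 < p.2) || (p.2 == 0) && (0 < p.1).

Lemma upperN (R : realType) (p : R * R) :
  p != (0, 0) -> upper (- p.1, - p.2) = ~~ upper p.
Proof.
case: p => [x y]; rewrite /upper /= xpair_eqE oppr_gt0 oppr_eq0 oppr_gt0.
by case: (ltgtP y 0); case: (ltgtP x 0).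
Qed.

(** Here A meets each line through the origin at most once, so a point of A is
    determined by the zero line of G that carries it. *)
Lemma card_points (R : realType) (m : nat) (G : {mpoly R[2]}) (q : R * R)
    (A : set (R * R)) :
    G \is m.-homog -> eval2 G q.1 q.2 != 0 ->
    (forall p, A p -> p != (0, 0) /\ eval2 G p.1 p.2 = 0) ->
    (forall p k, A p -> A (k * p.1, k * p.2) -> k = 1) ->
  A #<= `I_m.
Proof.
move=> homG Gq AG Ak; have [L leL LP] := zero_lines homG Gq.
apply: (@card_le_trans _ _ _ `I_(size L)); last by rewrite card_le_II.
apply: (card_le_seq (f := @line_of R)) => [p /AG[]|p p' Ap Ap'].
  exact: LP.
move=> /(line_of_eq (AG _ Ap).1)[k p'E]; rewrite p'E in Ap' *.
by rewrite (Ak _ _ Ap Ap') !mul1r; case: p {Ap Ap' p'E}.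
Qed.

(** Here A meets each line through the origin at most in an antipodal pair, so
    a point of A is determined by its line and its half-plane. *)
Lemma card_antipodal_points (R : realType) (m : nat) (G : {mpoly R[2]}) (q : R * R)
    (A : set (R * R)) :
    G \is m.-homog -> eval2 G q.1 q.2 != 0 ->
    (forall p, A p -> p != (0, 0) /\ eval2 G p.1 p.2 = 0) ->
    (forall p k, A p -> A (k * p.1, k * p.2) -> k = 1 \/ k = - 1) ->
  A #<= `I_(2 * m).
Proof.
move=> homG Gq AG Ak; have [L leL LP] := zero_lines homG Gq.
pose s := [seq (b, l) | b <- [:: true; false], l <- L].
apply: (@card_le_trans _ _ _ `I_(size s)); last first.
  by rewrite card_le_II size_allpairs leq_mul2l.
apply: (card_le_seq (f := fun p => (upper p, line_of p))) => [p /AG[p0 Gp]|p p' Ap Ap'].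
  by apply/allpairsP; exists (upper p, line_of p); split; rewrite ?LP//; case: upper.
have [p0 _] := AG _ Ap.
move=> [up /(line_of_eq p0)[k p'E]]; rewrite p'E in Ap' up *.
case: (Ak _ _ Ap Ap') up => ->; first by rewrite !mul1r; case: p {Ap Ap' p0 p'E}.
by rewrite !mulN1r upperN//; case: upper.
Qed.

(** * Angles *)

(** With w half the difference of the angles, cos (2 w) = 1 - 2 (sin w)^2 = 1,
    while sin w > 0 on ]0, pi[. *)
Lemma cos_sin_inj (R : realType) (t u : R) :
  0 <= t < 2 * pi -> 0 <= u < 2 * pi -> cos t = cos u -> sin t = sin u -> t = u.
Proof.
move=> tI uI ct st; wlog letu : t u tI uI ct st / t <= u.
  by move=> wl; have [tu|/ltW ut] := leP t u; [|apply/esym]; apply: wl.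
have : cos (u - t) = 1.
  by rewrite cosB ct st -!expr2 cos2Dsin2.
have -> : u - t = ((u - t) / 2) *+ 2 by lra.
rewrite cos_mulr2n cos2sin2 => h.
apply/eqP; rewrite eq_le letu /= leNgt; apply/negP => tu.
have : 0 < sin ((u - t) / 2) by apply: sin_gt0_pi; lra.
by move=> sgt0; nra.
Qed.

(** The numbers 1 / (k + 1) are at most 1 < 2 pi. *)
Lemma infinite_angles (R : realType) : infinite_set [set t : R | 0 <= t < 2 * pi].
Proof.
pose f (k : nat) : R := k.+1%:R^-1.
have finj : {in [set: nat] &, injective f}.
  by move=> i j _ _ /invr_inj /eqP; rewrite eqr_nat => /eqP[].
apply/infiniteP; rewrite -(card_le_eql (inj_card_eq finj)).
apply: subset_card_le => _ [k _ <-] /=; rewrite invr_ge0 ler0n /=.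
have /le_lt_trans : f k <= 1 by rewrite invf_le1 ?ltr0n// ler1n.
by apply; have := pi_ge2 R; lra.
Qed.

(** * Equilibria *)

(** The form x Q2 - y Q1, whose restriction to the unit circle is [polar_g]. *)
Definition angular_form (R : realType) (Q1 Q2 : {mpoly R[2]}) : {mpoly R[2]} :=
  'X_ord0 * Q2 - 'X_(lift ord0 ord0) * Q1.

Lemma eval2_angular_form (R : realType) (Q1 Q2 : {mpoly R[2]}) x y :
  eval2 (angular_form Q1 Q2) x y = x * eval2 Q2 x y - y * eval2 Q1 x y.
Proof. by rewrite /eval2 mevalB !mevalM !mevalXU. Qed.

Lemma angular_form_homog (R : realType) (n : nat) (Q1 Q2 : {mpoly R[2]}) :
  Q1 \is n.-homog -> Q2 \is n.-homog -> angular_form Q1 Q2 \is (n.+1).-homog.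
Proof.
by move=> h1 h2; apply: rpredB; apply: (dhomogM (d := 1)) => //;
  rewrite dhomogX; apply/eqP; exact: mdeg1.
Qed.

Lemma infinite_equilibriaE (R : realType) (lambda : R) (n : nat) Q1 Q2 :
    (0 < n)%N ->
  infinite_equilibria lambda n Q1 Q2 =
    [set t | 0 <= t < 2 * pi /\ eval2 (angular_form Q1 Q2) (cos t) (sin t) = 0].
Proof.
move=> n0.
have fieldE t : infinity_field lambda n Q1 Q2 (0, t) =
    (0, eval2 (angular_form Q1 Q2) (cos t) (sin t)).
  rewrite /infinity_field /= expr0n gtn_eqF//= mulr0 mul0r subr0.
  by rewrite eval2_angular_form.
by apply/seteqP; split=> t [tI tE]; split=> //; move: tE; rewrite fieldE;
  [case | move=> ->].
Qed.

(** At an equilibrium the field has no angular component, and its linear part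
    lambda (x, y) has none anywhere. *)
Lemma finite_equilibria_angular (R : realType) (lambda : R) Q1 Q2 p :
  finite_equilibria lambda Q1 Q2 p -> eval2 (angular_form Q1 Q2) p.1 p.2 = 0.
Proof.
case: p => x y [/= /eqP + /eqP]; rewrite !addr_eq0 eval2_angular_form.
by move=> /eqP + /eqP; nra.
Qed.

(** Subtracting k^n times the equations at p from those at k p leaves
    lambda k (1 - k^(n-1)) p = 0. *)
Lemma finite_equilibria_ratio (R : realType) (lambda : R) n Q1 Q2 p (k : R) :
    lambda != 0 -> (0 < n)%N -> Q1 \is n.-homog -> Q2 \is n.-homog ->
    (finite_equilibria lambda Q1 Q2 `\ (0, 0)) p ->
    (finite_equilibria lambda Q1 Q2 `\ (0, 0)) (k * p.1, k * p.2) ->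
  k ^+ n.-1 = 1.
Proof.
case: p n => x y [//|n] l0 _ h1 h2 [[/= e1 e2] p0] [[/= e1' e2'] kp0].
have k0 : k != 0.
  by apply/eqP => k0; apply: kp0; rewrite k0 !mul0r.
rewrite (eval2_homog _ _ _ h1) in e1'; rewrite (eval2_homog _ _ _ h2) in e2'.
(* One coordinate z of p, with q the value of the corresponding form. *)
have kE z q : lambda * z + q = 0 -> lambda * (k * z) + k ^+ n.+1 * q = 0 ->
    z != 0 -> k ^+ n = 1.
  move=> e e' z0; have /eqP : lambda * k * z * (1 - k ^+ n) = 0.
    have -> : lambda * k * z * (1 - k ^+ n) =
      (lambda * (k * z) + k ^+ n.+1 * q) - k ^+ n.+1 * (lambda * z + q).
      by rewrite exprS; ring.
    by rewrite e e' mulr0 subr0.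
  by rewrite !mulf_eq0 (negbTE l0) (negbTE k0) (negbTE z0) subr_eq0 /= => /eqP.
have [x0|] := eqVneq x 0; last exact: kE e1 e1'.
apply: kE e2 e2' _; apply/eqP => y0; apply: p0; by rewrite x0 y0.
Qed.

Lemma expr_eq1_pm (R : realType) (n : nat) (k : R) :
  (0 < n)%N -> k ^+ n = 1 -> k = 1 \/ k = - 1.
Proof.
move=> n0 kn; have /eqP : `|k| ^+ n == 1 by rewrite -normrX kn normr1.
move/eqP; rewrite pexpr_eq1// => /eqP; case: (ger0P k) => _ kE; first by left.
by right; rewrite -kE opprK.
Qed.

Theorem theorem3p5 (R : realType) (lambda : R) (n : nat) (Q1 Q2 : {mpoly R[2]})
    (lambda_neq0 : lambda != 0) (n_gt1 : (1 < n)%N)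
    (Q1_neq0 : Q1 != 0) (Q2_neq0 : Q2 != 0)
    (Q1_homog : Q1 \is n.-homog) (Q2_homog : Q2 \is n.-homog)
    (fin_inf : finite_set (infinite_equilibria lambda n Q1 Q2)) :
  [/\ infinite_equilibria lambda n Q1 Q2 #<= `I_(2 * n.+1),
      odd n -> finite_equilibria lambda Q1 Q2 `\ (0, 0) #<= `I_(2 * n.+1)
    & ~~ odd n -> finite_equilibria lambda Q1 Q2 `\ (0, 0) #<= `I_n.+1].
Proof.
have n0 : (0 < n)%N by exact: ltnW.
have n10 : (0 < n.-1)%N by case: n n_gt1 {n0 Q1_homog Q2_homog fin_inf} => [|[]].
have homG := angular_form_homog Q1_homog Q2_homog.
rewrite infinite_equilibriaE// in fin_inf *.
have [q Gq] : exists q, eval2 (angular_form Q1 Q2) q.1 q.2 != 0.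
  apply: contrapT => /forallNP G0; apply: (@infinite_angles R).
  apply: sub_finite_set fin_inf => t /= tI; split=> //; apply/eqP.
  exact/negPn/negP/(G0 (cos t, sin t)).
have finG p : (finite_equilibria lambda Q1 Q2 `\ (0, 0)) p ->
    p != (0, 0) /\ eval2 (angular_form Q1 Q2) p.1 p.2 = 0.
  by move=> [/finite_equilibria_angular Gp /eqP p0].
have ratio p k : (finite_equilibria lambda Q1 Q2 `\ (0, 0)) p ->
    (finite_equilibria lambda Q1 Q2 `\ (0, 0)) (k * p.1, k * p.2) ->
    k ^+ n.-1 = 1.
  exact: finite_equilibria_ratio.
split=> [|_|evn].
- have cs_inj : {in [set t | 0 <= t < 2 * pi /\
      eval2 (angular_form Q1 Q2) (cos t) (sin t) = 0] &,
      injective (fun t : R => (cos t, sin t))}.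
    by move=> t u; rewrite !inE => -[tI _] [uI _] [ct st]; apply: cos_sin_inj.
  rewrite -(card_le_eql (inj_card_eq cs_inj)).
  apply: (card_antipodal_points homG Gq) => [_ [t [_ Gt] <-]|_ k [t _ <-] [u _ /= [cu su]]].
    split=> //=; apply/eqP => -[ct st]; have := cos2Dsin2 t.
    by rewrite ct st expr0n addr0 => /esym/eqP; rewrite oner_eq0.
  apply: (@expr_eq1_pm _ 2) => //.
  have := cos2Dsin2 u; rewrite cu su !exprMn -mulrDr cos2Dsin2; lra.
- apply: (card_antipodal_points homG Gq finG) => p k Ap Akp.
  exact: expr_eq1_pm n10 (ratio _ _ Ap Akp).
- apply: (card_points homG Gq finG) => p k Ap Akp.
  have kn := ratio _ _ Ap Akp; have [//|kN1] := expr_eq1_pm n10 kn.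
  move: kn; rewrite kN1 -signr_odd -subn1 oddB// (negbTE evn) /= expr1 => ?; lra.
Qed.
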